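(* Let $\mathcal{O}\subset\mathbb{C}$ be the ring of $S$-integers in a number field, let $A,B,C\in\mathcal{O}$ be not all zero, let $\mathcal{B}$ be the multi-set of roots of $Ax^2+Bx+C$, and let $N\ge0$, $k\ge1$. Set $V:=V(\mathcal{B})_{N,k}$. Then $V_{N,k}(\mathbb{C})\subseteq V(\mathbb{C})^{\mathrm{div}}$; that is, $V_{N,k}(\mathbb{C})\subseteq V(\mathbb{C})$ and for every $(b_1,\ldots,b_N,a_1,\ldots,a_k)\in V_{N,k}(\mathbb{C})$ the periodic continued fraction $[b_1,\ldots,b_N,\overline{a_1,\ldots,a_k}]$ does not converge in $\mathbb{P}^1(\mathbb{C})$.
   Context: Put $D(c)=\begin{bmatrix}c&1\\1&0\end{bmatrix}$ and $M([c_1,\ldots,c_n])=D(c_1)\cdots D(c_n)$ (the identity if $n=0$). For variables $y_1,\ldots,y_N,x_1,\ldots,x_k$ let $$E_{N,k}=\begin{bmatrix}E_{11}&E_{12}\\ E_{21}&E_{22}\end{bmatrix}=M([y_1,\ldots,y_N])\,M([x_1,\ldots,x_k])\,M([y_1,\ldots,y_N])^{-1}.$$ The variety $V_{N,k}\subseteq\mathbb{A}^N\times\mathbb{A}^k$ is defined by $E_{21}=E_{22}-E_{11}=E_{12}=0$. The PCF variety $V(\mathcal{B})_{N,k}\subseteq\mathbb{A}^N\times\mathbb{A}^k$ is defined by $$A(E_{22}-E_{11})=BE_{21},\qquad -AE_{12}=CE_{21},\qquad -BE_{12}=C(E_{22}-E_{11}).$$ The periodic continued fraction $[b_1,\ldots,b_N,\overline{a_1,\ldots,a_k}]$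 is the infinite continued fraction with partial quotients $c_1,c_2,\ldots$ equal to $b_1,\ldots,b_N,a_1,\ldots,a_k,a_1,\ldots,a_k,\ldots$; its $n$-th convergent is $M([c_1,\ldots,c_n])_{11}/M([c_1,\ldots,c_n])_{21}\in\mathbb{P}^1(\mathbb{C})$, and it converges if the convergents have a limit in $\mathbb{P}^1(\mathbb{C})$. A point of $V(\mathbb{C})$ is called divergent if the associated periodic continued fraction does not converge; $V(\mathbb{C})^{\mathrm{div}}$ is the set of divergent points. *)

(* Defs.v *)
From HB Require Import structures.
From mathcomp Require Import all_boot all_order all_algebra fieldext.
From mathcomp Require Import all_classical all_reals all_analysis.
From mathcomp Require Import complex.

Set Implicit Arguments.
Unset Strict Implicit.
Unset Printing Implicit Defensive.

Import Order.TTheory GRing.Theory Num.Theory.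
Import numFieldNormedType.Exports.

Local Open Scope classical_set_scope.
Local Open Scope ring_scope.
Local Open Scope complex_scope.

Section AbsoluteValues.
Variables (R : realType) (K : fieldType).
Implicit Types (v w : K -> R) (S : set (K -> R)).

Record absolute_value v : Prop := AbsoluteValue {
  absv_ge0 : forall x, 0 <= v x;
  absv_eq0 : forall x, v x = 0 <-> x = 0;
  absvM : forall x y, v (x * y) = v x * v y;
  absvD : forall x y, v (x + y) <= v x + v y }.

Definition nontrivial_absolute_value v : Prop :=
  absolute_value v /\ exists2 x, x != 0 & v x != 1.

Definition nonarchimedean v : Prop :=
  forall x y, v (x + y) <= Num.max (v x) (v y).

Definition equivalent_absolute_values v w : Prop :=
  exists2 s : R, 0 < s & forall x, w x = v x `^ s.

(* The place (equivalence class) of v has a representative in S. *)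
Definition in_places S v : Prop :=
  exists2 w, S w & equivalent_absolute_values v w.

(* A finite set of places containing all archimedean ones, each place being
   given by representing absolute values. *)
Definition admissible_places S : Prop :=
  [/\ finite_set S,
      S `<=` nontrivial_absolute_value &
      forall v, nontrivial_absolute_value v -> ~ nonarchimedean v ->
        in_places S v].

Definition S_integers S : set K :=
  [set x | forall v, nontrivial_absolute_value v -> ~ in_places S v ->
     v x <= 1].

End AbsoluteValues.

Section ContinuedFractions.
Variable R : realType.
Local Notation C := R[i].

Definition cf_D (c : C) : 'M[C]_2 :=
  \matrix_(i < 2, j < 2) nth 0 (nth [::] [:: [:: c; 1]; [:: 1; 0]] i) j.

Definition cf_M (s : seq C) : 'M[C]_2 := \prod_(c <- s) cf_D c.

Definition pcf_E N k (p : N.-tuple C * k.-tuple C) : 'M[C]_2 :=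
  cf_M p.1 * cf_M p.2 * (cf_M p.1)^-1.

(* In 'I_2, index 0 is the first row or column, and 1 the second. *)
Definition V_Nk N k : set (N.-tuple C * k.-tuple C) :=
  [set p | let E := pcf_E p in
    [/\ E 1 0 = 0, E 1 1 - E 0 0 = 0 & E 0 1 = 0]].

(* V(B)_{N,k}, for B the multi-set of roots of A x^2 + B x + C (in P^1, so
   that infinity is a root when A = 0). *)
Definition PCF_variety (A B C0 : C) N k : set (N.-tuple C * k.-tuple C) :=
  [set p | let E := pcf_E p in
    [/\ A * (E 1 1 - E 0 0) = B * E 1 0,
        - A * E 0 1 = C0 * E 1 0 &
        - B * E 0 1 = C0 * (E 1 1 - E 0 0)]].

(* n is 0-based: this is c_{n+1}. *)
Definition pcf_quotient N k (p : N.-tuple C * k.-tuple C) (n : nat) : C :=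
  if (n < N)%N then nth 0 p.1 n else nth 0 p.2 ((n - N) %% k).

(* The complex projective line as the Riemann sphere, with None = infinity;
   the alias C^o carries the usual topology of C, given by its norm. *)
Definition P1 : topologicalType := one_point_compactification C^o.

(* The point x/y of P^1(C), for (x, y) nonzero. *)
Definition P1_ratio (x y : C) : P1 := if y == 0 then None else Some (x / y).

Definition convergent (c : nat -> C) (n : nat) : P1 :=
  P1_ratio (cf_M (mkseq c n) 0 0) (cf_M (mkseq c n) 1 0).

Definition pcf_converges N k (p : N.-tuple C * k.-tuple C) : Prop :=
  exists l : P1, convergent (pcf_quotient p) n @[n --> \oo] --> l.

Definition divergent_points N k (V : set (N.-tuple C * k.-tuple C)) :
    set (N.-tuple C * k.-tuple C) :=
  V `&` [set p | ~ pcf_converges p].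

End ContinuedFractions.

Arguments V_Nk R N k : clear implicits.
Arguments PCF_variety {R} A B C0 N k.

(* Main.v *)
(** If E is a scalar matrix then so is its conjugate M(x_1, ..., x_k), hence the
    convergents are k-periodic from index N on.  In the projective line, whose
    points are closed, a convergent periodic sequence is constant, whereas two
    successive convergents always differ, the matrices M being invertible. *)
Require Import Defs.
From mathcomp Require Import all_boot all_order all_algebra fieldext.
From mathcomp Require Import all_classical all_reals all_analysis.
From mathcomp Require Import complex.

Import Order.TTheory GRing.Theory Num.Theory.
Import numFieldNormedType.Exports.

Local Open Scope classical_set_scope.
Local Open Scope ring_scope.
Local Open Scope complex_scope.

(** Two finite points are separated by the image of an open set of [X], and a finite point is
    separated from infinity by the image of all of [X]. *)
Lemma accessible_one_point_compactification (X : topologicalType) :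
  accessible_space X -> accessible_space (one_point_compactification X).
Proof.
move=> accX [x|] [y|] // xy.
- have /accX[A [oA /set_mem Ax /set_mem nAy]] : x != y.
    by apply: contra_neq xy => ->.
  exists (Some @` A); split; rewrite ?inE; last first.
  - by move=> [z Az [zy]]; apply: nAy; rewrite -zy.
  - by exists x.
  - exact: one_point_compactification_open_some.
- exists (Some @` setT); split; rewrite ?inE; [| by exists x | by case].
  by apply: one_point_compactification_open_some; exact: openT.
(* To separate infinity from [Some y], remove that point. The result is a neighbourhood of each
   finite [z] by the T1 property of [X], and of infinity because [[set y]] is compact and closed. *)
- exists (~` [set Some y]); split; rewrite ?inE //; last exact.
  rewrite openE => -[z|] zy; rewrite /interior /=.
    have /accX[A [oA /set_mem Az /set_mem nAy]] : z != y.
      by apply/eqP => zyE; apply: zy; rewrite zyE.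
    apply: filterS (open_nbhs_nbhs (conj oA Az)) => t At [ty].
    by apply: nAy; rewrite -ty.
  exists [set y].
    by split; [exact: compact_set1 | exact: accessible_closed_set1].
  by move=> t [[s sy <-] [/sy] | ->].
Qed.

(** Otherwise some open set around [l] misses [a]; the sequence eventually stays in it, yet takes
    the value [a] at arbitrarily large indices. *)
Lemma accessible_cvg_frequently_eq (T : topologicalType) (u : nat -> T)
    (a l : T) :
  accessible_space T -> u n @[n --> \oo] --> l ->
  (forall n, exists2 m, (n <= m)%N & u m = a) -> l = a.
Proof.
move=> accT ul ua; apply: contrapT => /eqP /accT.
move=> [A [oA /set_mem Al /set_mem nAa]].
have [n _ An] : \forall n \near \oo, A (u n).
  by apply: ul; exact: open_nbhs_nbhs.
have [m nm uma] := ua n.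
by apply: nAa; rewrite -uma; exact: An.
Qed.

Lemma sum_ord2 (V : nmodType) (F : 'I_2 -> V) : \sum_i F i = F 0 + F 1.
Proof.
by rewrite !big_ord_recl big_ord0 addr0; congr (F _ + F _); apply: val_inj.
Qed.

Lemma mulmx2E (R : pzSemiRingType) (m n : nat) (A : 'M[R]_(m, 2))
    (B : 'M[R]_(2, n)) i j :
  (A *m B) i j = A i 0 * B 0 j + A i 1 * B 1 j.
Proof. by rewrite mxE sum_ord2. Qed.

Lemma det_mx22 (R : comPzRingType) (A : 'M[R]_2) :
  \det A = A 0 0 * A 1 1 - A 0 1 * A 1 0.
Proof.
rewrite (expand_det_row _ 0) sum_ord2 /cofactor !det_mx11 !mxE /=.
rewrite addn0 add0n expr0 expr1 mul1r mulN1r mulrN.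
by do ![congr (_ * _)| congr (_ + _) | congr (- _) | congr (A _ _)];
  apply: val_inj.
Qed.

Lemma mkseqD (T : Type) (f : nat -> T) (m n : nat) :
  mkseq f (m + n) = mkseq f m ++ mkseq (fun i => f (m + i)%N) n.
Proof.
rewrite /mkseq iotaD map_cat add0n -{2}[m]addn0.
by rewrite [iota (m + 0) n]iotaDl -map_comp.
Qed.

Section ContinuedFractions.
Variable R : realType.
Local Notation C := R[i].

Lemma P1_ratio_cross (x y z w : C) :
  P1_ratio x y = P1_ratio z w -> x * w = z * y.
Proof.
rewrite /P1_ratio; case: eqP => [->|/eqP y0]; case: eqP => [->|/eqP w0] //.
  by rewrite !mulr0.
by case=> /eqP; rewrite eqr_div // => /eqP.
Qed.

Lemma P1_ratioZ (e x y : C) : e != 0 -> P1_ratio (e * x) (e * y) = P1_ratio x y.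
Proof.
move=> e0; rewrite /P1_ratio mulf_eq0 (negbTE e0) /=.
by rewrite -mulf_div divff // mul1r.
Qed.

Lemma cf_M_cat (s t : seq C) : cf_M (s ++ t) = cf_M s * cf_M t.
Proof. exact: big_cat. Qed.

Lemma cf_D_unit (c : C) : cf_D c \is a GRing.unit.
Proof.
rewrite unitmxE det_mx22 !mxE /= mulr0 sub0r mul1r.
by rewrite unitrN unitr1.
Qed.

Lemma cf_M_unit (s : seq C) : cf_M s \is a GRing.unit.
Proof.
elim: s => [|c s IHs]; first by rewrite /cf_M big_nil unitr1.
by rewrite -cat1s cf_M_cat unitrMl // /cf_M big_seq1 cf_D_unit.
Qed.

(** Multiplying [M] by [cf_D x] on the right turns its first column into [x] times that column plus
    the second. Equal convergents would make the two columns of [M] proportional. *)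
Lemma convergentS_neq (c : nat -> C) (n : nat) :
  convergent c n.+1 <> convergent c n.
Proof.
rewrite /convergent mkseqS -cats1 cf_M_cat {2 4}/cf_M big_seq1.
have := cf_M_unit (mkseq c n); set M := cf_M _.
rewrite unitmxE det_mx22 unitfE => detM /P1_ratio_cross.
rewrite !mulmx2E !mxE /= !mulr1.
(* The terms containing the new quotient cancel, and what remains says that [\det M] is zero. *)
rewrite mulrDl mulrDr mulrAC mulrA => /addrI cross.
by rewrite cross subrr eqxx in detM.
Qed.

Lemma cf_M_pcf_quotient N k (p : N.-tuple C * k.-tuple C) (n : nat) :
  cf_M (mkseq (pcf_quotient p) (N + n)) =
  cf_M p.1 * cf_M (mkseq (fun i => nth 0 p.2 (i %% k)%N) n).
Proof.
rewrite mkseqD cf_M_cat; congr (cf_M _ * cf_M _).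
  rewrite -[RHS](mkseq_nth 0) size_tuple; apply/eq_in_map => i.
  by rewrite mem_iota /pcf_quotient => /andP[_ ->].
by apply: eq_mkseq => i; rewrite /pcf_quotient ltnNge leq_addr addKn.
Qed.

Lemma cf_M_cycle k (t : k.-tuple C) (n : nat) :
  cf_M (mkseq (fun i => nth 0 t (i %% k)%N) (k + n)) =
  cf_M t * cf_M (mkseq (fun i => nth 0 t (i %% k)%N) n).
Proof.
rewrite mkseqD cf_M_cat; congr (cf_M _ * cf_M _).
  rewrite -[RHS](mkseq_nth 0) size_tuple; apply/eq_in_map => i.
  by rewrite mem_iota => /andP[_ ik]; rewrite modn_small.
by apply: eq_mkseq => i; rewrite modnDl.
Qed.

Lemma V_Nk_scalar N k (p : N.-tuple C * k.-tuple C) :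
  V_Nk R N k p -> exists2 e : C, e != 0 & cf_M p.2 = e%:M.
Proof.
move=> [E10 /eqP + E01]; rewrite subr_eq0 => /eqP E11.
have Ee : pcf_E p = (pcf_E p 0 0)%:M.
  apply/matrixP => i j; rewrite [RHS]mxE.
  case: i => [[|[|//]] i2]; case: j => [[|[|//]] j2];
    rewrite ?mulr1n ?mulr0n.
  - by congr (pcf_E p _ _); apply: val_inj.
  - by rewrite -E01; congr (pcf_E p _ _); apply: val_inj.
  - by rewrite -E10; congr (pcf_E p _ _); apply: val_inj.
  - by rewrite -E11; congr (pcf_E p _ _); apply: val_inj.
move: Ee; move: (pcf_E p 0 0) => e Ee.
have Me : cf_M p.2 = e%:M.
  apply: (mulrI (cf_M_unit p.1)).
  (* Inserting the inverse of [cf_M p.1] followed by [cf_M p.1] makes [pcf_E p] appear; being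
     scalar, it commutes past [cf_M p.1], which then cancels. *)
  rewrite -[LHS](mulrVK (cf_M_unit p.1)) -/(pcf_E p) Ee.
  exact: comm_scalar_mx.
exists e => //; apply: contraTneq (cf_M_unit p.2) => e0.
by rewrite Me e0 raddf0 unitr0.
Qed.

(** The additional period contributes a nonzero scalar factor, common to both homogeneous
    coordinates. *)
Lemma convergent_periodic N k (p : N.-tuple C * k.-tuple C) (n : nat) :
  V_Nk R N k p ->
  convergent (pcf_quotient p) (N + (k + n)) =
  convergent (pcf_quotient p) (N + n).
Proof.
move=> /V_Nk_scalar[e e0 Me].
rewrite /convergent !cf_M_pcf_quotient cf_M_cycle Me mulrA.
have -> : cf_M p.1 * e%:M = e *: cf_M p.1 by exact: mul_mx_scalar.
by rewrite -scalerAl [X in P1_ratio X _]mxE [X in P1_ratio _ X]mxE P1_ratioZ.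
Qed.

Lemma limit_pcf N k (p : N.-tuple C * k.-tuple C) (l : P1 R) (n : nat) :
  (0 < k)%N -> V_Nk R N k p ->
  convergent (pcf_quotient p) i @[i --> \oo] --> l ->
  l = convergent (pcf_quotient p) (N + n).
Proof.
move=> k0 Vp pl; apply: accessible_cvg_frequently_eq pl _.
  apply: accessible_one_point_compactification.
  exact/hausdorff_accessible/norm_hausdorff.
(* Going [m] periods further reaches an index at least [m], as [k] is positive. *)
move=> m; exists (N + (m * k + n))%N.
  by rewrite addnCA -[leqLHS]addn0 leq_add // leq_pmulr.
by elim: m => [//|m IHm]; rewrite mulSn -addnA convergent_periodic.
Qed.

End ContinuedFractions.

Theorem corollary4p4 (R : realType) (K : fieldExtType rat)
    (iota : {rmorphism K -> R[i]}) (S : set (K -> R)) (A B C : R[i])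
    (N k : nat) :
  admissible_places S ->
  (iota @` S_integers S) A ->
  (iota @` S_integers S) B ->
  (iota @` S_integers S) C ->
  ~ [/\ A = 0, B = 0 & C = 0] ->
  (1 <= k)%N ->
  V_Nk R N k `<=` divergent_points (PCF_variety A B C N k).
Proof.
move=> _ _ _ _ _ k0 p Vp; split.
  (* Both sides of each equation of the PCF variety vanish. *)
  by case: Vp => E10 E11 E01; split; rewrite ?E10 ?E11 ?E01 !mulr0.
move=> [l pl]; apply: (@convergentS_neq _ (pcf_quotient p) N).
(* The offset 1 is legitimate even for [k = 1], since [limit_pcf] does not bound the offset by the
   period. *)
by rewrite -addn1 -(limit_pcf _ _ _ _ _ 1%N k0 Vp pl)
  (limit_pcf _ _ _ _ _ 0%N k0 Vp pl) addn0.
Qed.
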